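(* Let $G$ be an undirected graph on the vertex set $\{1,\dots,n\}$, $n\ge 3$, with set of directed edges $Dir(E)$. Then the cone $\mathrm{QMET}(G)$ is the set of functions $d\in\mathbb{R}^{Dir(E)}$ such that (i) for every directed edge $(i,j)$ of $G$, $0\le d(i,j)$; (ii) for every oriented cycle $(v_1,v_2,\dots,v_m)$ of $G$, $$d(v_1,v_m)\le d(v_1,v_2)+d(v_2,v_3)+\dots+d(v_{m-1},v_m).$$ Likewise, the cone $\mathrm{WQMET}(G)$ is the set of functions $d\in\mathbb{R}^{Dir(E)}$ satisfying (i), (ii) and the extra condition that there exists a function $w:\{1,\dots,n\}\to\mathbb{R}$ such that $d(i,j)-d(j,i)=w_i-w_j$ for every directed edge $(i,j)$ of $G$.
   Context: Graphs are finite and simple. For an undirected graph $G$ on $\{1,\dots,n\}$ with edge set $E$, $Dir(E)$ is the set of directed edges of $G$: each edge $\{i,j\}\in E$ gives the two directed edges $(i,j)$ and $(j,i)$. An oriented cycle $(v_1,\dots,v_m)$ of $G$, $m\ge 3$, is a sequence of distinct vertices such that $v_k$ and $v_{k+1}$ are adjacent for $1\le k<m$ and $v_m$ and $v_1$ are adjacent (all starting points and both directions of traversal are allowed). $K_n$ is the complete graph on $\{1,\dots,n\}$. $\mathrm{QMET}(K_n)$ is the cone of functions $d$ on ordered pairs of distinct elements of $\{1,\dots,n\}$ (not assumed symmetric) satisfying $d(i,j)\ge 0$ for all $i\neq j$ and the oriented triangle inequality $d(i,j)\le d(i,k)+d(k,j)$ for all distinct $i,j,k$. A $d\in \mathrm{QMET}(K_n)$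 is weightable if there is a function $w$ on $\{1,\dots,n\}$ with $d(i,j)+w_i=d(j,i)+w_j$ for all $i\ne j$; equivalently $d(i,j)+d(j,k)+d(k,i)=d(j,i)+d(k,j)+d(i,k)$ for all $i,j,k$. $\mathrm{WQMET}(K_n)$ is the cone of weightable elements of $\mathrm{QMET}(K_n)$. $\mathrm{QMET}(G)$ and $\mathrm{WQMET}(G)$ are defined as the images of $\mathrm{QMET}(K_n)$ and $\mathrm{WQMET}(K_n)$ under the coordinate projection onto $\mathbb{R}^{Dir(E)}$. *)

(* Defs.v *)
From mathcomp Require Import all_boot all_order all_algebra.
From mathcomp Require Import boolp classical_sets reals.
Set Implicit Arguments.
Unset Strict Implicit.
Unset Printing Implicit Defensive.
Import Order.TTheory GRing.Theory Num.Theory.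
Local Open Scope ring_scope.
Local Open Scope classical_set_scope.

(* The vertex set {1, ..., n} is represented by 'I_n. *)
Record sgraph (n : nat) := SGraph {
  adj :> rel 'I_n;
  adj_sym : symmetric adj;
  adj_irr : irreflexive adj }.

Notation dir_edge G := {e : 'I__ * 'I__ | adj G e.1 e.2}.

Definition complete_rel n : rel 'I_n := fun i j => i != j.

Lemma complete_sym n : symmetric (@complete_rel n).
Proof. by move=> i j; rewrite /complete_rel eq_sym. Qed.

Lemma complete_irr n : irreflexive (@complete_rel n).
Proof. by move=> i; rewrite /complete_rel eqxx. Qed.

Definition complete n : sgraph n :=
  SGraph (@complete_sym n) (@complete_irr n).

Lemma adj_complete n (G : sgraph n) (i j : 'I_n) : G i j -> complete n i j.
Proof. by move=> Gij; apply/eqP => eij; rewrite eij adj_irr in Gij. Qed.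

(* d(i, j). The junk value 0 is returned when (i, j) is not a directed edge;
   below, [dval d i j] is only used at pairs that are directed edges. *)
Definition dval (R : realType) n (G : sgraph n) (d : {ffun dir_edge G -> R})
    (i j : 'I_n) : R :=
  if insub (i, j) is Some e then d e else 0.

Definition QMETK (R : realType) n : set {ffun dir_edge (complete n) -> R} :=
  [set d | (forall i j, i != j -> 0 <= dval d i j) /\
           (forall i j k, i != j -> i != k -> j != k ->
              dval d i j <= dval d i k + dval d k j)].
Arguments QMETK R n _ : clear implicits.

Definition weightable (R : realType) n
    (d : {ffun dir_edge (complete n) -> R}) : Prop :=
  exists w : 'I_n -> R,
    forall i j, i != j -> dval d i j + w i = dval d j i + w j.

Definition WQMETK (R : realType) n : set {ffun dir_edge (complete n) -> R} :=
  [set d | QMETK R n d /\ weightable d].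
Arguments WQMETK R n _ : clear implicits.

Definition dir_incl n (G : sgraph n) (e : dir_edge G) :
    dir_edge (complete n) :=
  exist _ (val e) (adj_complete (valP e)).

Definition dir_proj (R : realType) n (G : sgraph n)
    (d : {ffun dir_edge (complete n) -> R}) : {ffun dir_edge G -> R} :=
  [ffun e => d (dir_incl e)].

Definition QMET (R : realType) n (G : sgraph n) :
    set {ffun dir_edge G -> R} :=
  @dir_proj R n G @` QMETK R n.
Arguments QMET R {n} G _.

Definition WQMET (R : realType) n (G : sgraph n) :
    set {ffun dir_edge G -> R} :=
  @dir_proj R n G @` WQMETK R n.
Arguments WQMET R {n} G _.

Definition oriented_cycle n (G : sgraph n) (s : seq 'I_n) : bool :=
  [&& (3 <= size s)%N, uniq s & cycle G s].

(* d(v_1, v_2) + ... + d(v_(m-1), v_m) for v_1 = x and p = (v_2, ..., v_m) *)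
Definition path_length (R : realType) n (G : sgraph n)
    (d : {ffun dir_edge G -> R}) (x : 'I_n) (p : seq 'I_n) : R :=
  \sum_(k < size p) dval d (nth x (x :: p) k) (nth x (x :: p) k.+1).

(* Main.v *)
Require Import Defs.
From mathcomp Require Import all_boot all_order all_algebra.
From mathcomp Require Import boolp classical_sets reals.
From mathcomp Require Import lra.
Set Implicit Arguments.
Unset Strict Implicit.
Unset Printing Implicit Defensive.
Import Order.TTheory GRing.Theory Num.Theory.
Local Open Scope ring_scope.
Local Open Scope classical_set_scope.

(* To extend d from G to K_n, give every pair (i, j) that is not a directed
   edge the cost B - u i, where B is large and u is the weight function of d (or
   0 if none is prescribed), and take the shortest-walk quasi-metric of the
   resulting costs. A walk that leaves G is too expensive to shortcut an edge
   of G, and a walk inside G reduces to a simple path, which closes up to a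
   cycle, so that (ii) applies. The cost of the non-edges makes u a weight of
   the costs on all pairs, so reversing a walk changes its length by a
   telescoping amount, and u is a weight of the shortest-walk quasi-metric. *)

(** * Walks and the shortest-walk quasi-metric of a cost function *)

Section Walks.
Variables (R : realType) (T : eqType) (c : T -> T -> R).

Fixpoint walk_length (x : T) (p : seq T) : R :=
  if p is y :: q then c x y + walk_length y q else 0.

Lemma walk_length_cat x p q :
  walk_length x (p ++ q) = walk_length x p + walk_length (last x p) q.
Proof. by elim: p x => [|y p IH] x /=; rewrite ?add0r // IH addrA. Qed.

Lemma walk_length_rev (u : T -> R) x p :
    (forall i j, c i j + u i = c j i + u j) ->
  exists2 q, last (last x p) q = x &
    walk_length x p + u x = walk_length (last x p) q + u (last x p).
Proof.
move=> cu; elim: p x => [|y p IH] x /=; first by exists [::].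
have [q lq eq_q] := IH y; exists (q ++ [:: x]); first by rewrite last_cat.
rewrite walk_length_cat /= lq; have := cu x y; lra.
Qed.

Hypothesis c_ge0 : forall x y, 0 <= c x y.

Lemma walk_length_ge0 x p : 0 <= walk_length x p.
Proof. by elim: p x => [|y p IH] x //=; rewrite addr_ge0. Qed.

(** Costs are nonnegative, so cutting a closed part out of a walk never lengthens it. *)
Lemma simple_path_le_walk (e : rel T) x p : path e x p ->
  exists p', [/\ path e x p', uniq (x :: p'), last x p' = last x p &
                 walk_length x p' <= walk_length x p].
Proof.
elim: p x => [|y p IH] x; first by exists [::].
move=> /= /andP[exy /IH[p' [ep' Up' lp' le_p']]].
have [xp'|xNp'] := boolP (x \in y :: p'); last first.
  exists (y :: p'); split=> //=; first by rewrite exy.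
    by rewrite xNp'.
  by rewrite lerD2l.
(* [x] recurs at the end of [p1], so the closed walk [y :: p1] is dropped and [p2] continues from
   [x]. *)
case/splitPl: xp' ep' Up' lp' le_p' => p1 p2 lp1.
rewrite cat_path last_cat lp1 => /andP[_ ep2] Up lp.
rewrite walk_length_cat lp1 => le_p.
exists p2; split=> //.
  rewrite -cat_cons lastI lp1 cat_rcons cat_uniq in Up.
  by case/and3P: Up.
have := walk_length_ge0 y p1; have := c_ge0 x y; lra.
Qed.

Lemma walk_length_ge_offpath (e : rel T) (b : R) x p :
  (forall i j, ~~ e i j -> b <= c i j) -> ~~ path e x p ->
  b <= walk_length x p.
Proof.
move=> cb; elim: p x => [|y p IH] x //=.
rewrite negb_and => /orP[/cb le_b|/IH le_b].
  by rewrite (le_trans le_b) // lerDl walk_length_ge0.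
by rewrite (le_trans le_b) // lerDr c_ge0.
Qed.

(** Every sequence of points counts as a walk, so the direct step keeps the set nonempty; [c_ge0]
    bounds it below by 0. *)
Definition walk_dist (x y : T) : R :=
  inf [set walk_length x p | p in [set p | last x p = y]].

Lemma walk_dist_le x p : walk_dist x (last x p) <= walk_length x p.
Proof.
apply: ge_inf; last by exists p.
by exists 0 => _ [q _ <-]; apply: walk_length_ge0.
Qed.

Lemma walk_dist_ge a x y :
  (forall p, last x p = y -> a <= walk_length x p) -> a <= walk_dist x y.
Proof.
move=> le_a; apply: lb_le_inf; first by exists (walk_length x [:: y]), [:: y].
by move=> _ [p /le_a le_ap <-].
Qed.

Lemma walk_dist_ge0 x y : 0 <= walk_dist x y.
Proof. by apply: walk_dist_ge => p _; apply: walk_length_ge0. Qed.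

Lemma walk_dist_triangle x y z :
  walk_dist x z <= walk_dist x y + walk_dist y z.
Proof.
(* The infima are treated one at a time: moving one across turns the claim into a lower bound on the
   other, until the single walk [p ++ q] decides. *)
rewrite -lerBlDr; apply: walk_dist_ge => p lp.
rewrite lerBlDr -lerBlDl; apply: walk_dist_ge => q lq.
have := walk_dist_le x (p ++ q).
by rewrite walk_length_cat last_cat lp lq lerBlDl.
Qed.

Lemma walk_dist_weight (u : T -> R) x y :
    (forall i j, c i j + u i = c j i + u j) ->
  walk_dist x y + u x = walk_dist y x + u y.
Proof.
move=> cu; suff le_w a b : walk_dist a b + u a <= walk_dist b a + u b.
  by apply/le_anti; rewrite !le_w.
rewrite -lerBrDr -addrA -lerBlDr; apply: walk_dist_ge => p lp.
have [q lq eq_q] := walk_length_rev b p cu.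
have := walk_dist_le a q; rewrite lp in lq eq_q; rewrite lq; lra.
Qed.

End Walks.

(** * Edge values and the polygon inequality *)

Lemma eq_walk_length (R : realType) (T : eqType) (c c' : T -> T -> R)
    (e : rel T) x p :
  (forall i j, e i j -> c i j = c' i j) -> path e x p ->
  walk_length c x p = walk_length c' x p.
Proof.
by move=> eq_c; elim: p x => //= y p IH x /andP[/eq_c -> /IH ->].
Qed.

Lemma path_lengthE (R : realType) n (G : sgraph n) (d : {ffun dir_edge G -> R})
    x p : path_length d x p = walk_length (dval d) x p.
Proof.
rewrite /path_length.
(* The default of [nth] is the head [x], which changes along the induction, so it is first replaced
   by a fixed [x0]. *)
suff E x0 : \sum_(k < size p)
    dval d (nth x0 (x :: p) k) (nth x0 (x :: p) k.+1) =
    walk_length (dval d) x p by [].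
elim: p x => [|y p IH] x /=; first by rewrite big_ord0.
by rewrite big_ord_recl /= -IH.
Qed.

Lemma dvalE (R : realType) n (G : sgraph n) (d : {ffun dir_edge G -> R})
    (e : dir_edge G) : dval d (val e).1 (val e).2 = d e.
Proof. by rewrite /dval -surjective_pairing valK. Qed.

Lemma dval_finfun (R : realType) n (G : sgraph n) (f : 'I_n -> 'I_n -> R) i j :
  G i j -> dval [ffun e : dir_edge G => f (val e).1 (val e).2] i j = f i j.
Proof.
move=> Gij; pose e : dir_edge G := exist _ (i, j) Gij.
by rewrite -[LHS]/(dval _ (val e).1 (val e).2) dvalE ffunE.
Qed.

Lemma dval_dir_proj (R : realType) n (G : sgraph n)
    (d : {ffun dir_edge (complete n) -> R}) i j :
  G i j -> dval (dir_proj G d) i j = dval d i j.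
Proof.
move=> Gij; pose e : dir_edge G := exist _ (i, j) Gij.
by rewrite -[LHS]/(dval _ (val e).1 (val e).2) dvalE ffunE -dvalE.
Qed.

(** The triangle inequality is iterated along the path; distinctness of the vertices supplies its
    side conditions. *)
Lemma polygon_inequality (R : realType) n
    (d : {ffun dir_edge (complete n) -> R}) x p :
  QMETK R n d -> uniq (x :: p) -> p != [::] ->
  dval d x (last x p) <= walk_length (dval d) x p.
Proof.
move=> [_ tri]; elim: p x => // y [|z p] IH x Uxp _; first by rewrite /= addr0.
have /andP[xNp Uyp] := Uxp.
have le_y := IH y Uyp isT.
apply: le_trans (_ : dval d x y + dval d y (last y (z :: p)) <= _); last first.
  by rewrite lerD2l.
have lzp : last z p \in z :: p by apply: mem_last.
apply: tri.
- by apply: contraNneq xNp => ->; rewrite inE [last _ _ \in _]lzp orbT.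
- by apply: contraNneq xNp => ->; rewrite inE eqxx.
- by case/andP: Uyp => yNp _; apply: contraNneq yNp => <-.
Qed.

(** * Extension from [G] to the complete graph *)

Section Extension.
Variables (R : realType) (n : nat) (G : sgraph n) (d : {ffun dir_edge G -> R}).

(** Necessity: all pairs in the cycle inequality are edges of [G], so it is a polygon inequality of
    [D] in coordinates that the projection keeps. *)
Lemma dir_proj_conditions (D : {ffun dir_edge (complete n) -> R}) :
    QMETK R n D -> dir_proj G D = d ->
  (forall i j, G i j -> 0 <= dval d i j) /\
  (forall v1 p, oriented_cycle G (v1 :: p) ->
     dval d v1 (last v1 p) <= path_length d v1 p).
Proof.
move=> HD <-; split=> [i j Gij|x p /and3P[sz Uxp]].
  by rewrite dval_dir_proj //; case: HD => D0 _; apply/D0/adj_complete/Gij.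
rewrite /= rcons_path => /andP[Gp Glx].
rewrite path_lengthE (eq_walk_length (@dval_dir_proj R n G D) Gp).
rewrite dval_dir_proj 1?adj_sym //.
by apply: polygon_inequality => //; case: p sz {Uxp Gp Glx}.
Qed.

Variable u : 'I_n -> R.
Hypothesis d_ge0 : forall i j, G i j -> 0 <= dval d i j.
Hypothesis d_cycle : forall v1 p, oriented_cycle G (v1 :: p) ->
  dval d v1 (last v1 p) <= path_length d v1 p.

(** The second sum absorbs [u i], so a non-edge still costs at least the sum of all [d e], hence at
    least each of them. *)
Let bound := \sum_e d e + \sum_i `|u i|.

Let cost i j := if G i j then dval d i j else bound - u i.

Let d_ge0' e : 0 <= d e.
Proof. by rewrite -dvalE d_ge0 //; case: e. Qed.

Let cost_offG i j : ~~ G i j -> \sum_e d e <= cost i j.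
Proof.
move=> /negbTE Gij; rewrite /cost Gij /bound -addrA lerDl subr_ge0.
by rewrite (bigD1 i) //= (le_trans (ler_norm _)) // lerDl sumr_ge0.
Qed.

Let cost_ge0 i j : 0 <= cost i j.
Proof.
have [Gij|Gij] := boolP (G i j); first by rewrite /cost Gij d_ge0.
by apply: le_trans (cost_offG Gij); apply: sumr_ge0.
Qed.

Let walk_dist_edge i j : G i j -> walk_dist cost i j = dval d i j.
Proof.
move=> Gij; apply: le_anti; apply/andP; split.
  have := walk_dist_le cost_ge0 i [:: j].
  by rewrite /= addr0 {2}/cost Gij.
apply: walk_dist_ge => p lp.
have [Gp|GNp] := boolP (path G i p); last first.
  apply: le_trans (walk_length_ge_offpath cost_ge0 cost_offG GNp).
  pose e : dir_edge G := exist _ (i, j) Gij.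
  rewrite -[leLHS]/(dval d (val e).1 (val e).2) dvalE.
  by rewrite (bigD1 e) //= lerDl sumr_ge0.
have [q [Gq Uq lq]] := simple_path_le_walk cost_ge0 Gp; apply: le_trans.
have costE a b : G a b -> cost a b = dval d a b by rewrite /cost => ->.
rewrite (eq_walk_length costE Gq); rewrite lp in lq.
(* An empty [q] would make a loop, one vertex gives the edge itself, and two or more close up to an
   oriented cycle through the edge from [j] to [i]. *)
case: q => [|y [|z q]] in Gq Uq lq *.
- by move: Gij; rewrite -lq adj_irr.
- by rewrite -lq /= addr0.
- rewrite -path_lengthE -lq d_cycle // /oriented_cycle Uq /=.
  by move: Gq lq => /= /and3P[-> -> Gq] lq; rewrite rcons_path Gq lq adj_sym.
Qed.

(** The weight clause is an implication, so that one extension serves both cones. *)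
Lemma QMETK_extension : exists D : {ffun dir_edge (complete n) -> R},
  [/\ QMETK R n D, dir_proj G D = d &
      (forall i j, G i j -> dval d i j + u i = dval d j i + u j) ->
      forall i j, i != j -> dval D i j + u i = dval D j i + u j].
Proof.
pose D := [ffun e : dir_edge (complete n) =>
  walk_dist cost (val e).1 (val e).2].
have DE i j : i != j -> dval D i j = walk_dist cost i j.
  exact: (@dval_finfun _ _ (complete n)).
exists D; split.
- split=> [i j /DE ->|i j k ij ik jk]; first exact: walk_dist_ge0.
  by rewrite !DE 1?[k == j]eq_sym //; apply: walk_dist_triangle.
- by apply/ffunP => e; rewrite !ffunE /= walk_dist_edge ?dvalE //; case: e.
- move=> du i j ij; rewrite !DE 1?[j == i]eq_sym //.
  apply: walk_dist_weight => // a b; rewrite /cost adj_sym.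
  by case: ifP => [/du //|_]; rewrite !subrK.
Qed.

End Extension.

Theorem theorem3 (R : realType) (n : nat) (G : sgraph n) (hn : (3 <= n)%N) :
  QMET R G =
    [set d : {ffun dir_edge G -> R} |
      (forall i j, G i j -> 0 <= dval d i j) /\
      (forall (v1 : 'I_n) (p : seq 'I_n), oriented_cycle G (v1 :: p) ->
         dval d v1 (last v1 p) <= path_length d v1 p)] /\
  WQMET R G =
    [set d : {ffun dir_edge G -> R} |
      [/\ (forall i j, G i j -> 0 <= dval d i j),
          (forall (v1 : 'I_n) (p : seq 'I_n), oriented_cycle G (v1 :: p) ->
             dval d v1 (last v1 p) <= path_length d v1 p)
        & exists w : 'I_n -> R,
            forall i j, G i j -> dval d i j - dval d j i = w i - w j]].
Proof.
split; apply/seteqP; split=> d /=.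
- by case=> D HD projD; apply: dir_proj_conditions HD projD.
- case=> d0 dC; have [D [HD projD _]] := QMETK_extension (fun=> 0) d0 dC.
  by exists D.
- case=> D [HD [w Dw]] projD; have [d0 dC] := dir_proj_conditions HD projD.
  (* The weight conventions of [weightable] and of the extra condition differ by a sign. *)
  split=> //; exists (fun i => - w i) => i j Gij.
  have Gji : G j i by rewrite adj_sym.
  rewrite -projD !dval_dir_proj //.
  have := Dw i j (adj_complete Gij); lra.
- case=> d0 dC [w dw].
  have [D [HD projD Dw]] := QMETK_extension (fun i => - w i) d0 dC.
  exists D => //; split=> //; exists (fun i => - w i); apply: Dw => i j Gij.
  have := dw i j Gij; lra.
Qed.
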